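(* Let $k\ge 3$ be an integer, $m=2^{k-2}$ and $n=4m-1=2^k-1$. Let $\mathcal{C}$ be a centered maximal $n$-element clique of the collinearity graph of $\mathcal{P}_m(n)$ and let $O$ be a center point of $\mathcal{C}$. There is a unique maximal $(2m-1)$-element clique $\mathcal{X}$ in the collinearity graph of the geometry formed by $m$-element subsets of $O^c=[n]\setminus O$, and for every $(2m-1)$-element subset $Z\subset O$ there is a unique maximal $(2m-1)$-element clique $\mathcal{Y}$ in the collinearity graph of the geometry of $m$-element subsets of $Z$, such that $\mathcal{C}=\mathcal{X}\#_{\delta}\mathcal{Y}$ for a certain bijection $\delta:\mathcal{X}\to\mathcal{Y}$.
   Context: For a finite set $V$ and a positive integer $t$ with $|V|\ge 3t$, the geometry of $2t$-element subsets of $V$ is the point-line geometry whose points are all $2t$-element subsets of $V$ and whose lines are all triples $\{X,Y,X\triangle Y\}$ such that $X,Y$ are distinct and $X,Y,X\triangle Y$ are all $2t$-element subsets. Two distinct points $X,Y$ are collinear if and only if $|X\cap Y|=t$; the collinearity graph has the points as vertices with distinct collinear points adjacent. $\mathcal{P}_m(n)$ is this geometry for $V=[n]=\{1,\dots,n\}$, $t=m$. The geometries of $m$-element subsets of a $(2m-1)$-element set are obtained with $t=m/2$ (note $m/2=2^{k-3}$ is an integer). A clique is maximal if it is maximal with respect to inclusion. A point $O\in\mathcal{C}$ of a maximal clique $\mathcal{C}$ is a center point of $\mathcal{C}$ if for every $C\in\mathcal{C}\setminus\{O\}$ the line joining $C$ and $O$ is contained in $\mathcal{C}$, i.e. $O\triangle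 C\in\mathcal{C}$; a maximal clique is centered if it has a center point. For a set $\mathcal{X}$ of $m$-element subsets of $O^c$, a set $\mathcal{Y}$ of $m$-element subsets of a $(2m-1)$-element subset of the $2m$-element set $O$, and a bijection $\delta:\mathcal{X}\to\mathcal{Y}$, $$\mathcal{X}\#_{\delta}\mathcal{Y}=\{O\}\cup\{X\cup\delta(X): X\in\mathcal{X}\}\cup\{X\cup(O\setminus\delta(X)): X\in\mathcal{X}\}.$$ *)

(* Defs.v *)
From mathcomp Require Import all_boot.

Set Implicit Arguments.
Unset Strict Implicit.
Unset Printing Implicit Defensive.

Section SubsetGeometry.

Variable T : finType.
Implicit Types (A B O X V : {set T}) (C XX YY : {set {set T}}).

Definition symdiff A B : {set T} := (A :\: B) :|: (B :\: A).

(* The geometry of 2t-element subsets of V is parametrized by t, the common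
   intersection size of collinear points; it is only considered for
   0 < t and 3 * t <= #|V|. *)
Definition points V (t : nat) : {set {set T}} :=
  [set A : {set T} | (A \subset V) && (#|A| == 2 * t)].

Definition line_through A B : {set {set T}} := [set A; B; symdiff A B].

Definition lines V (t : nat) : {set {set {set T}}} :=
  [set line_through A B | A in points V t, B in points V t
                        & (A != B) && (symdiff A B \in points V t)].

Definition collinear V (t : nat) A B : bool :=
  (A != B) && [exists L in lines V t, (A \in L) && (B \in L)].

Definition is_clique V (t : nat) C : bool :=
  (C \subset points V t) &&
  [forall A in C, forall B in C, (A != B) ==> collinear V t A B].

Definition maximal_clique V (t : nat) C : bool := maxset (is_clique V t) C.

(* Meaningful when C is a maximal clique. *)
Definition center_point C O : Prop :=
  O \in C /\ (forall A, A \in C :\ O -> line_through O A \subset C).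

Definition centered C : Prop := exists O, center_point C O.

(* Bijections XX -> YY are represented by total functions, whose values
   outside XX are irrelevant. *)
Definition bijection_between (delta : {set T} -> {set T}) XX YY : Prop :=
  {in XX &, injective delta} /\ delta @: XX = YY.

(* XX #_delta YY, where YY = delta @: XX. *)
Definition sharp O (delta : {set T} -> {set T}) XX : {set {set T}} :=
  O |: ([set A :|: delta A | A in XX]
          :|: [set A :|: (O :\: delta A) | A in XX]).

Definition is_sharp O C XX YY : Prop :=
  exists delta, bijection_between delta XX YY /\ C = sharp O delta XX.

End SubsetGeometry.

(* Main.v *)
Require Import Defs.
From mathcomp Require Import all_boot.
From mathcomp Require Import zify.

Set Implicit Arguments.
Unset Strict Implicit.
Unset Printing Implicit Defensive.

(** Write m = 2t, so that the members of C have 4t elements, the ground set has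
8t - 1, and O and its complement have 4t and 4t - 1. Since O is a center, C
without O is stable under the involution exchanging A and the symmetric
difference of O and A: this keeps the trace of A outside O and complements the
trace of A inside O.

Let A and B be members of C other than O that are neither equal nor exchanged
by the involution. Both B and its partner meet A in 2t elements, and so does O.
Hence the parts of O in A and B, of O in A but not in B, and of A and B outside
O satisfy three linear equations, whose only solution is that each of them has
t elements ([clique_traces]). So the outer traces pairwise meet in t elements,
and so do the inner traces once a single member is kept in every orbit of the
involution. A point z of O makes such a choice: of the two partners exactly
one avoids z, and its inner trace lies in O minus z. Sets of size 2t meeting
in t are distinct, so both traces are injective on this half of C, and sending
the outer trace of a member to its inner trace is the bijection delta.

Both trace families have (8t - 2) / 2 = 4t - 1 members. A double count with
the Cauchy-Schwarz inequality shows that a clique of 2t-element subsets of a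
(4t - 1)-element set never has more members ([clique_card_bound]), so both
are maximal.

Conversely, if C is glued from X and Y, every member of X (resp. Y) is the
outer (resp. inner) trace of a glued set that avoids z, so X and Y are
contained in the trace families ([is_sharp_sub]); equality follows by
cardinality. *)

(** * Collinearity as an intersection condition *)

Section Collinearity.

Variable T : finType.
Implicit Types (A B O V : {set T}) (C : {set {set T}}).

Lemma symdiffC A B : symdiff A B = symdiff B A.
Proof. by rewrite /symdiff setUC. Qed.

Lemma symdiffK A B : symdiff A (symdiff A B) = B.
Proof.
apply/setP=> x; rewrite !inE.
by case: (x \in A); case: (x \in B).
Qed.

Lemma card_symdiff A B : #|symdiff A B| + 2 * #|A :&: B| = #|A| + #|B|.
Proof.
have dAB : [disjoint A :\: B & B :\: A].
  rewrite -setI_eq0; apply/eqP/setP=> x; rewrite !inE.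
  by case: (x \in A); case: (x \in B).
rewrite /symdiff cardsU (eqP (_ : (A :\: B) :&: (B :\: A) == set0));
  last by rewrite setI_eq0.
have := cardsID B A; have := cardsID A B; rewrite cards0 [B :&: A]setIC; lia.
Qed.

Lemma symdiff_in_points V t A B : A \in points V t -> B \in points V t ->
  (symdiff A B \in points V t) = (#|A :&: B| == t).
Proof.
rewrite !inE => /andP[sAV /eqP cA] /andP[sBV /eqP cB].
have -> : symdiff A B \subset V.
  by rewrite subUset !(subset_trans (subsetDl _ _)).
have := card_symdiff A B; rewrite cA cB /= => cAB.
by apply/eqP/eqP; lia.
Qed.

(** Any two of P, Q and their symmetric difference determine the third, so
it does not matter which two members of a line A and B are. *)
Lemma collinearE V t A B : A \in points V t -> B \in points V t ->
  collinear V t A B = (A != B) && (#|A :&: B| == t).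
Proof.
move=> pA pB; rewrite /collinear; case: eqVneq => //= nAB.
rewrite -(symdiff_in_points pA pB); apply/idP/idP => [|pAB].
  case/exists_inP=> L /imset2P[P Q pP].
  rewrite inE => /and3P[pQ _ pPQ] ->; rewrite !in_setU !in_set1 => /andP[].
  have PPQ := symdiffK P Q; have QPQ := symdiffK Q P.
  rewrite [symdiff Q P]symdiffC in QPQ.
  case/orP=> [/orP[]|] /eqP eA; case/orP=> [/orP[]|] /eqP eB; subst A B;
    rewrite ?eqxx // in nAB *;
    by rewrite ?[symdiff (symdiff _ _) _]symdiffC ?PPQ ?QPQ // symdiffC.
apply/exists_inP; exists (line_through A B); last by rewrite !inE !eqxx ?orbT.
by apply/imset2P; exists A B => //; rewrite inE pB nAB.
Qed.

Lemma is_cliqueP V t C :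
  reflect ({in C, forall A, A \subset V /\ #|A| = 2 * t} /\
           {in C &, forall A B, A != B -> #|A :&: B| = t})
          (is_clique V t C).
Proof.
apply: (iffP andP) => [[/subsetP sC /forall_inP cC]|[pC cC]].
  split=> [A /sC|A B CA CB nAB]; first by rewrite inE => /andP[? /eqP].
  have/forall_inP/(_ _ CB)/implyP/(_ nAB) := cC _ CA.
  by rewrite collinearE ?sC // nAB => /eqP.
have sC : {in C, forall A, A \in points V t}.
  by move=> A /pC[sA cA]; rewrite inE sA cA /=.
split; first by apply/subsetP.
apply/forall_inP=> A CA; apply/forall_inP=> B CB; apply/implyP=> nAB.
by rewrite collinearE ?sC // nAB cC //=.
Qed.

End Collinearity.

(** * A Fisher-type bound on cliques *)

Section CliqueBound.

Variable T : finType.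
Implicit Types (A B V : {set T}) (C : {set {set T}}).

Lemma sum_mem_card V A : A \subset V -> \sum_(x in V) (x \in A : nat) = #|A|.
Proof.
move=> /setIidPr sA; rewrite -[in RHS]sA -sum1_card big_mkcond [RHS]big_mkcond.
by apply: eq_bigr => x _; rewrite inE; case: (x \in V); case: (x \in A).
Qed.

(** With N members, the degree d x of a point of V sums to 2tN, and its square,
which counts pairs of members through x, sums to tN + tN^2. The average degree
would be (N + 1) / 2 in the extremal case #|V| = 4t - 1 = N, so the inequality
comes from summing (2 d x - (N + 1))^2 >= 0 over V. *)
Lemma clique_card_bound V t C :
  is_clique V t C -> 4 * t * #|C| <= #|V| * #|C|.+1.
Proof.
case/is_cliqueP=> pC cC; set N := #|C|.
pose d x := \sum_(A in C) (x \in A : nat).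
have sum_d : \sum_(x in V) d x = 2 * t * N.
  rewrite /d exchange_big /= mulnC -sum_nat_const.
  by apply: eq_bigr => A /pC[sA <-]; apply: sum_mem_card.
have sum_d2 : \sum_(x in V) d x ^ 2 = t * N * N.+1.
  transitivity (\sum_(A in C) \sum_(B in C) #|A :&: B|).
    under eq_bigr => x _ do rewrite -mulnn /d big_distrlr.
    rewrite exchange_big /=; apply: eq_bigr => A CA.
    rewrite exchange_big /=; apply: eq_bigr => B CB.
    rewrite -(@sum_mem_card V); last by rewrite subIset // (proj1 (pC _ CA)).
    by apply: eq_bigr => x _; rewrite inE mulnb.
  have -> : t * N * N.+1 = N * (t * N.+1) by nia.
  rewrite -sum_nat_const.
  apply: eq_bigr => A CA; rewrite (bigD1 A) //= setIid (proj2 (pC _ CA)).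
  rewrite (eq_bigr (fun=> t)); last first.
    by move=> B /andP[CB nBA]; apply: cC; rewrite // eq_sym.
  rewrite sum_nat_cond_const.
  have -> : #|[set B in C | B != A]| = N.-1.
    rewrite /N (cardsD1 A C) CA /=; apply: eq_card => B.
    by rewrite !inE andbC.
  (* 2t from the diagonal pair and t from each of the N - 1 others *)
  have : 0 < N by apply/card_gt0P; exists A.
  by case: N {sum_d} => // N' _ /=; nia.
have : \sum_(x in V) 2 * (2 * d x * N.+1)
       <= \sum_(x in V) ((2 * d x) ^ 2 + N.+1 ^ 2).
  by apply: leq_sum => x _; apply: nat_Cauchy.
have -> : \sum_(x in V) 2 * (2 * d x * N.+1) = 4 * N.+1 * (2 * t * N).
  by rewrite -sum_d big_distrr; apply: eq_bigr => x _ /=; lia.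
have -> : \sum_(x in V) ((2 * d x) ^ 2 + N.+1 ^ 2) =
          4 * (t * N * N.+1) + #|V| * N.+1 ^ 2.
  rewrite big_split /= sum_nat_const -sum_d2 big_distrr; congr (_ + _).
  by apply: eq_bigr => x _ /=; rewrite expnMn.
move=> le_sums; rewrite -(leq_pmul2r (ltn0Sn N)); nia.
Qed.

Lemma maximal_clique_card V t C : 0 < t -> #|V| = 4 * t - 1 ->
  is_clique V t C -> #|C| = #|V| -> maximal_clique V t C.
Proof.
move=> t0 cV clC cC; apply/maxsetP; split=> // D clD sCD.
apply/esym/eqP; rewrite eqEcard sCD cC.
have := clique_card_bound clD; rewrite cV; nia.
Qed.

End CliqueBound.

(** * Traces of a centered clique *)

Lemma factor_through_inj_in (I aT : finType) (bT : Type) (b0 : bT)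
    (f : I -> aT) (g : I -> bT) (D : {set I}) : {in D &, injective f} ->
  exists h : aT -> bT, {in D, forall i, h (f i) = g i}.
Proof.
move=> inj_f; exists (fun a => oapp g b0 [pick i in D | f i == a]) => i iD.
case: pickP => [j /andP[jD /eqP/inj_f-> //]|/(_ i)]; by rewrite iD eqxx.
Qed.

Section CenteredClique.

Variables (T : finType) (t : nat) (C : {set {set T}}) (O : {set T}).
Hypotheses (t_gt0 : 0 < t) (clC : is_clique [set: T] (2 * t) C).
Hypotheses (cenO : center_point C O).
Implicit Types (A B Z : {set T}) (z : T).

Lemma card_clique A : A \in C -> #|A| = 4 * t.
Proof. by case/is_cliqueP: clC => pC _ /pC[_ ->]; rewrite mulnA. Qed.

Lemma card_cliqueI A B : A \in C -> B \in C -> A != B -> #|A :&: B| = 2 * t.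
Proof. by case/is_cliqueP: clC => _ cC CA CB; apply: cC. Qed.

Lemma center_in : O \in C. Proof. by case: cenO. Qed.

Lemma clique_symdiff A : A \in C :\ O -> symdiff O A \in C :\ O.
Proof.
move=> CA; case: cenO => _ /(_ A CA)/subsetP/(_ (symdiff O A)).
rewrite !inE eqxx orbT => /(_ isT)->; rewrite andbT.
move: CA; rewrite !inE => /andP[_ CA]; apply: contraTneq t_gt0 => eO.
have A0 : A = set0.
  by rewrite -(symdiffK O A) eO; apply/setP=> x; rewrite !inE; case: (x \in O).
by have := card_clique CA; rewrite A0 cards0; lia.
Qed.

(** Three unknowns, the cardinals p, r, q of the parts of A in O and B, in O but
not in B, and in B but not in O, satisfy p + q = q + r = p + r = 2t. *)
Lemma clique_traces A B : A \in C :\ O -> B \in C :\ O ->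
    A != B -> A != symdiff O B ->
  #|(A :&: O) :&: (B :&: O)| = t /\ #|(A :\: O) :&: (B :\: O)| = t.
Proof.
move=> CA CB nAB nAOB; have COB := clique_symdiff CB.
move: CA CB COB; rewrite !inE => /andP[nAO CA] /andP[_ CB] /andP[_ COB].
have := card_cliqueI CA CB nAB; have := card_cliqueI CA COB nAOB.
have := card_cliqueI CA center_in nAO.
have <- := cardsID B (A :&: O).
have <- := cardsID O (A :&: symdiff O B); have <- := cardsID O (A :&: B).
have -> : A :&: symdiff O B :&: O = A :&: O :\: B.
  by apply/setP=> x; rewrite !inE; case: (x \in O); case: (x \in B);
    rewrite ?andbF ?andbT.
have -> : A :&: symdiff O B :\: O = (A :\: O) :&: (B :\: O).
  by apply/setP=> x; rewrite !inE; case: (x \in O); case: (x \in B);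
    rewrite ?andbF ?andbT.
have -> : A :&: B :\: O = (A :\: O) :&: (B :\: O).
  by apply/setP=> x; rewrite !inE; case: (x \in O); rewrite ?andbF.
have -> : A :&: O :&: B = (A :&: O) :&: (B :&: O).
  by apply/setP=> x; rewrite !inE; case: (x \in O); rewrite ?andbF ?andbT.
have -> : A :&: B :&: O = (A :&: O) :&: (B :&: O).
  by apply/setP=> x; rewrite !inE; case: (x \in O); rewrite ?andbF ?andbT.
lia.
Qed.

Lemma card_inner_trace A : A \in C :\ O -> #|A :&: O| = 2 * t.
Proof.
by rewrite !inE => /andP[nAO CA]; apply: card_cliqueI => //; apply: center_in.
Qed.

Lemma card_outer_trace A : A \in C :\ O -> #|A :\: O| = 2 * t.
Proof.
move=> CA; have := cardsID O A; rewrite card_inner_trace //.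
by case/setD1P: CA => _ /card_clique->; lia.
Qed.

(** A representative system for the pairs exchanged by symmetric difference
with O, as z belongs to O. *)
Definition half_clique z : {set {set T}} := [set A in C :\ O | z \notin A].

Definition outer_traces : {set {set T}} := [set A :\: O | A in C :\ O].

Definition inner_traces z : {set {set T}} :=
  [set A :&: O | A in half_clique z].

Section Half.

Variable z : T.
Hypothesis zO : z \in O.

(** As z lies in O, exactly one of A and its partner contains z. *)
Lemma half_clique_symdiff A :
  (symdiff O A \in C :\ O) && (z \in symdiff O A) = (A \in half_clique z).
Proof.
have -> : (symdiff O A \in C :\ O) = (A \in C :\ O).
  by apply/idP/idP=> /clique_symdiff //; rewrite symdiffK.
by rewrite !inE zO /= andbT orbF.
Qed.

Lemma clique_half_split :
  C :\ O = half_clique z :|: symdiff O @: half_clique z.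
Proof.
apply/setP=> A; rewrite in_setU; apply/idP/orP=> [CA|[|/imsetP[B]]].
- case zA: (z \in A); [right|by left; rewrite inE CA zA].
  apply/imsetP; exists (symdiff O A); last by rewrite symdiffK.
  by rewrite -half_clique_symdiff symdiffK CA.
- by rewrite inE => /andP[].
- by rewrite -half_clique_symdiff => /andP[? _] ->.
Qed.

Lemma card_half_clique : 2 * #|half_clique z| = #|C|.-1.
Proof.
have -> : #|C|.-1 = #|C :\ O| by rewrite (cardsD1 O C) center_in.
rewrite clique_half_split cardsU card_imset; last exact: (can_inj (symdiffK O)).
rewrite (_ : _ :&: _ = set0) ?cards0 ?subn0 ?mul2n ?addnn //.
apply/setP=> A; rewrite in_setI in_set0; apply/negP=> /andP[].
rewrite inE => /andP[_ /negP zA] /imsetP[B].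
by rewrite -half_clique_symdiff => /andP[_ zB] eA; rewrite eA in zA.
Qed.

Lemma half_clique_traces A B :
    A \in half_clique z -> B \in half_clique z -> A != B ->
  #|(A :&: O) :&: (B :&: O)| = t /\ #|(A :\: O) :&: (B :\: O)| = t.
Proof.
move=> AD BD nAB; have := BD; rewrite -half_clique_symdiff => /andP[_ zOB].
move: AD BD; rewrite [A \in _]inE [B \in _]inE => /andP[CA zA] /andP[CB _].
by apply: clique_traces => //; apply: contraNneq zA => ->.
Qed.

Lemma inner_trace_inj : {in half_clique z &, injective (fun A => A :&: O)}.
Proof.
move=> A B AD BD eAB; apply/eqP/negPn/negP=> nAB.
have [+ _] := half_clique_traces AD BD nAB; rewrite -eAB setIid.
by move: AD; rewrite inE => /andP[CA _]; rewrite card_inner_trace; lia.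
Qed.

Lemma outer_trace_inj : {in half_clique z &, injective (fun A => A :\: O)}.
Proof.
move=> A B AD BD eAB; apply/eqP/negPn/negP=> nAB.
have [_ +] := half_clique_traces AD BD nAB; rewrite -eAB setIid.
by move: AD; rewrite inE => /andP[CA _]; rewrite card_outer_trace; lia.
Qed.

(** Partners have the same outer trace, which is why the family of outer traces
does not depend on z. *)
Lemma outer_tracesE : outer_traces = [set A :\: O | A in half_clique z].
Proof.
rewrite /outer_traces clique_half_split imsetU; apply/setUidPl.
apply/subsetP=> _ /imsetP[_ /imsetP[A AD ->] ->].
apply/imsetP; exists A => //.
by apply/setP=> x; rewrite !inE; case: (x \in O); case: (x \in A).
Qed.

Lemma card_outer_traces : #|outer_traces| = #|half_clique z|.
Proof. by rewrite outer_tracesE card_in_imset //; apply: outer_trace_inj. Qed.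

Lemma card_inner_traces : #|inner_traces z| = #|half_clique z|.
Proof. by rewrite card_in_imset //; apply: inner_trace_inj. Qed.

Lemma outer_traces_clique : is_clique (~: O) t outer_traces.
Proof.
rewrite outer_tracesE; apply/is_cliqueP; split=> [_ /imsetP[A AD ->]|].
  move: AD; rewrite inE => /andP[CA _]; rewrite card_outer_trace //.
  by rewrite setDE subsetIr.
move=> _ _ /imsetP[A AD ->] /imsetP[B BD ->] nAB.
by apply: (proj2 (half_clique_traces AD BD _)); apply: contraNneq nAB => ->.
Qed.

Lemma inner_traces_clique : is_clique (O :\ z) t (inner_traces z).
Proof.
apply/is_cliqueP; split=> [_ /imsetP[A AD ->]|].
  move: AD; rewrite inE => /andP[CA zA]; rewrite card_inner_trace //.
  by rewrite subsetD1 subsetIr inE negb_and zA.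
move=> _ _ /imsetP[A AD ->] /imsetP[B BD ->] nAB.
by apply: (proj1 (half_clique_traces AD BD _)); apply: contraNneq nAB => ->.
Qed.

(** The members avoiding z provide the sets glued with delta, and their partners
the sets glued with the complement of delta in O. *)
Lemma is_sharp_traces : is_sharp O C outer_traces (inner_traces z).
Proof.
have [delta deltaE] := factor_through_inj_in set0 (fun A => A :&: O) outer_trace_inj.
exists delta; rewrite outer_tracesE; split; [split|].
- move=> _ _ /imsetP[A AD ->] /imsetP[B BD ->]; rewrite !deltaE //.
  by move/(inner_trace_inj AD BD)->.
- by rewrite -imset_comp; apply: eq_in_imset => A AD /=; apply: deltaE.
- rewrite /sharp -(setD1K center_in) clique_half_split -!imset_comp.
  congr (_ |: (_ :|: _)); [rewrite -[LHS]imset_id|]; apply: eq_in_imset;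
    move=> A AD /=; rewrite deltaE //; apply/setP=> x; rewrite !inE;
    by case: (x \in O); case: (x \in A).
Qed.

(** For A in X, the glued set of A and delta A avoids z, because A lies outside
O and delta A in O minus z; so it belongs to the half of C whose traces are
taken, and its traces are A and delta A. *)
Lemma is_sharp_sub X Y : is_clique (~: O) t X -> is_clique (O :\ z) t Y ->
  is_sharp O C X Y -> X \subset outer_traces /\ Y \subset inner_traces z.
Proof.
case/is_cliqueP=> pX _ /is_cliqueP[pY _] [delta [[_ defY] defC]].
have glueX A : A \in X -> [/\ A :|: delta A \in half_clique z,
    (A :|: delta A) :\: O = A & (A :|: delta A) :&: O = delta A].
  move=> AX; have [sAO cA] := pX A AX.
  have dY : delta A \in Y by rewrite -defY imset_f.
  have [/subsetD1P[sdO zd] _] := pY _ dY.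
  have AO x : x \in A -> x \in O = false.
    by move/(subsetP sAO); rewrite inE => /negbTE.
  have gD : (A :|: delta A) :\: O = A.
    apply/setP=> x; rewrite !inE.
    case xA: (x \in A) => /=; first by rewrite AO.
    by case xd: (x \in delta A); rewrite ?andbF // (subsetP sdO).
  have gI : (A :|: delta A) :&: O = delta A.
    apply/setP=> x; rewrite !inE.
    case xd: (x \in delta A) => /=; first by rewrite orbT (subsetP sdO).
    by case xA: (x \in A) => //=; rewrite AO.
  split=> //; rewrite !inE negb_or zd andbT; apply/andP; split; last first.
    by apply: contraL zO => /AO->.
  apply/andP; split; last first.
    by rewrite defC !in_setU (imset_f (fun B => B :|: delta B)) ?orbT.
  (* a glued set equal to O would have the empty outer trace A *)
  apply: contraTneq t_gt0 => eO.
  by move: cA; rewrite -gD eO setDv cards0; lia.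
split; apply/subsetP.
  move=> A /glueX[AD <- _]; rewrite outer_tracesE.
  by apply/imsetP; exists (A :|: delta A).
rewrite -defY => _ /imsetP[A /glueX[AD _ <-] ->].
by apply/imsetP; exists (A :|: delta A).
Qed.

End Half.

End CenteredClique.

(** * The decomposition *)

Lemma setD1_of_card (T : finType) (O Z : {set T}) : Z \subset O ->
  #|O| = #|Z|.+1 -> exists2 z, z \in O & Z = O :\ z.
Proof.
move=> sZO cO; have : #|O :\: Z| == 1 by rewrite cardsDS // cO subSnn.
case/cards1P=> z eOZ; exists z.
  by have := set11 z; rewrite -eOZ inE => /andP[].
by rewrite -eOZ setDDr setDv set0U; apply/esym/setIidPr.
Qed.

Theorem proposition3 (k m n : nat) (hk : 3 <= k) (hm : m = 2 ^ (k - 2))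
    (hn : n = 4 * m - 1) (C : {set {set 'I_n}})
    (hmax : maximal_clique [set: 'I_n] m C) (hcard : #|C| = n)
    (hcent : centered C) (O : {set 'I_n}) (hO : center_point C O) :
  exists X : {set {set 'I_n}},
    (maximal_clique (~: O) (m %/ 2) X /\ #|X| = 2 * m - 1) /\
    forall Z : {set 'I_n}, Z \subset O -> #|Z| = 2 * m - 1 ->
      exists Y : {set {set 'I_n}},
        (maximal_clique Z (m %/ 2) Y /\ #|Y| = 2 * m - 1) /\
        is_sharp O C X Y /\
        (forall X' Y' : {set {set 'I_n}},
           maximal_clique (~: O) (m %/ 2) X' -> #|X'| = 2 * m - 1 ->
           maximal_clique Z (m %/ 2) Y' -> #|Y'| = 2 * m - 1 ->
           is_sharp O C X' Y' -> X' = X /\ Y' = Y).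
Proof.
have : 0 < m by rewrite hm expn_gt0.
have : 2 %| m by rewrite hm dvdn_exp // subn_gt0.
(* halving m below is exact, as m is a power of 2 with exponent k - 2 > 0 *)
case/dvdnP=> t; rewrite mulnC => mE; rewrite {}mE {m hm} mulKn // in hn hmax *.
rewrite muln_gt0 /= => t0; have clC := maxsetp hmax.
have OC := center_in hO; have cO := card_clique clC OC.
have cOc : #|~: O| = 4 * t - 1 by have := cardsC O; rewrite cO card_ord; lia.
have cH z : z \in O -> #|half_clique C O z| = 4 * t - 1.
  by move=> zO; have := card_half_clique t0 clC hO zO; rewrite hcard; lia.
have [z0 z0O] : exists z, z \in O by apply/card_gt0P; rewrite cO; lia.
have cX : #|outer_traces C O| = 4 * t - 1.
  by rewrite (card_outer_traces t0 clC hO z0O) cH.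
exists (outer_traces C O); split.
  split; last by rewrite cX; lia.
  apply: maximal_clique_card; rewrite ?cX ?cOc //.
  exact: outer_traces_clique clC hO z0 z0O.
move=> Z sZO cZ; have [z zO eZ] : exists2 z, z \in O & Z = O :\ z.
  by apply: setD1_of_card => //; rewrite ?cZ ?cO; lia.
have cY : #|inner_traces C O z| = 4 * t - 1.
  by rewrite (card_inner_traces t0 clC hO zO) cH.
have {}cZ : #|O :\ z| = 4 * t - 1 by rewrite -eZ cZ; lia.
rewrite eZ; exists (inner_traces C O z); split; [split|split].
- apply: maximal_clique_card; rewrite ?cY ?cZ //.
  exact: inner_traces_clique.
- by rewrite cY; lia.
- by have := is_sharp_traces t0 clC hO zO.
move=> X Y /maxsetp clX cX' /maxsetp clY cY' shXY.
have [sX sY] := is_sharp_sub t0 clC hO zO clX clY shXY.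
by split; apply/eqP; rewrite eqEcard ?sX ?sY ?cX ?cY ?cX' ?cY' /=; lia.
Qed.
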